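(* Let $F_A$ be the free group with finite basis $A$. The finite index problem for $F_A$ is computable: there exists an algorithm which, given a finite family of words $v_1,\ldots,v_k$ in $A^{\pm}=A\sqcup A^{-1}$, decides whether the subgroup $H=\langle v_1,\ldots,v_k\rangle\leqslant F_A$ has finite index in $F_A$ and, if so, computes the index $[F_A:H]$ and a family of representatives of the cosets of $H$ in $F_A$.
   Context: $A^{-1}$ denotes the set of formal inverses of the letters in $A$. Cosets are right cosets $Hg$, and a family of representatives (transversal) is a family $\{g_i\}_{i\in I}$ in $F_A$ with $F_A=\bigsqcup_{i\in I}Hg_i$. *)

(* Defs.v *)
From HB Require Import structures.
From mathcomp Require Import all_boot.
From mathcomp Require Import boolp classical_sets cardinality.

Set Implicit Arguments.
Unset Strict Implicit.
Unset Printing Implicit Defensive.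

Local Open Scope classical_set_scope.
Local Open Scope card_scope.
Local Open Scope group_scope.

(** A letter of [A + A] is [inl a], standing for the basis element [a], or
    [inr a], standing for its formal inverse. The elements of the free group
    are the reduced words, multiplied by concatenation followed by free
    reduction. *)

Definition letter_inv (A : Type) (l : A + A) : A + A :=
  match l with inl a => inr a | inr a => inl a end.

Lemma letter_invK (A : Type) : involutive (@letter_inv A).
Proof. by case. Qed.

Definition reduced (A : eqType) (w : seq (A + A)) : bool :=
  sorted (fun k l => l != letter_inv k) w.

Record freeGroup (A : eqType) :=
  FreeGroup { fword :> seq (A + A); fwordP : reduced fword }.

HB.instance Definition _ (A : eqType) := [isSub for @fword A].
HB.instance Definition _ (A : eqType) := [Equality of freeGroup A by <:].
HB.instance Definition _ (A : choiceType) := [Choice of freeGroup A by <:].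
HB.instance Definition _ (A : countType) := [Countable of freeGroup A by <:].

Section FreeGroupTheory.
Variable A : choiceType.
Implicit Types (l : A + A) (u v w : seq (A + A)) (x y z : freeGroup A).

Definition push l w : seq (A + A) :=
  if w is k :: w' then if k == letter_inv l then w' else l :: w else [:: l].

Lemma push_reduced l w : reduced w -> reduced (push l w).
Proof.
case: w => [//|k w] /= rw; case: eqP => [_|/eqP kl] /=; last by rewrite kl.
by rewrite /reduced; apply: path_sorted rw.
Qed.

Lemma foldr_push_reduced u w : reduced w -> reduced (foldr push w u).
Proof. by move=> rw; elim: u => //= l u; apply: push_reduced. Qed.

Lemma pushK l w : reduced w -> push l (push (letter_inv l) w) = w.
Proof.
case: w => [_|k w] /=; first by rewrite eqxx.
rewrite letter_invK; case: eqVneq => [->|_ _] /=; last by rewrite eqxx.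
by case: w => [//|k' w] /= /andP[/negPf ->].
Qed.

Lemma foldr_push_cons l u w :
  reduced w -> foldr push w (push l u) = push l (foldr push w u).
Proof.
move=> rw; case: u => [//|k u] /=; case: eqP => [->|//] /=.
by rewrite pushK// foldr_push_reduced.
Qed.

Lemma foldr_pushA u v w : reduced w ->
  foldr push w (foldr push v u) = foldr push (foldr push w v) u.
Proof. by move=> rw; elim: u => //= l u <-; rewrite foldr_push_cons. Qed.

Lemma foldr_push_nil u : reduced u -> foldr push [::] u = u.
Proof.
elim: u => //= l u IHu ru; rewrite IHu; last exact: path_sorted ru.
by case: u ru {IHu} => //= k u /andP[/negPf ->].
Qed.

Definition word_inv u := rev (map (@letter_inv A) u).

Lemma word_invK : involutive word_inv.
Proof.
by move=> u; rewrite /word_inv map_rev revK -map_comp map_id_in// => l _; case: l.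
Qed.

Lemma word_inv_reduced u : reduced u -> reduced (word_inv u).
Proof.
rewrite /reduced /word_inv rev_sorted sorted_map; apply: sub_sorted => k l /=.
by case: k => a; case: l => b //=; apply: contra => /eqP[->].
Qed.

Lemma foldr_push_inv u : foldr push u (word_inv u) = [::].
Proof.
elim: u => // l u IHu.
by rewrite /word_inv /= rev_cons foldr_rcons /= letter_invK eqxx.
Qed.

Definition fg_one : freeGroup A := @FreeGroup A [::] isT.
Definition fg_mul x y : freeGroup A :=
  FreeGroup (foldr_push_reduced x (fwordP y)).
Definition fg_inv x : freeGroup A := FreeGroup (word_inv_reduced (fwordP x)).

Fact fg_mulA : associative fg_mul.
Proof.
by move=> x y z; apply: val_inj; rewrite /= foldr_pushA//; apply: fwordP.
Qed.

Fact fg_mul1 : left_id fg_one fg_mul.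
Proof. by move=> x; apply: val_inj. Qed.

Fact fg_mulr1 : right_id fg_one fg_mul.
Proof. by move=> x; apply: val_inj; apply: foldr_push_nil; apply: fwordP. Qed.

Fact fg_mulV : left_inverse fg_one fg_inv fg_mul.
Proof. by move=> x; apply: val_inj; apply: foldr_push_inv. Qed.

Fact fg_mulrV : right_inverse fg_one fg_inv fg_mul.
Proof.
move=> x; apply: val_inj => /=.
by have := foldr_push_inv (word_inv x); rewrite word_invK.
Qed.

End FreeGroupTheory.

HB.instance Definition _ (A : choiceType) := isGroup.Build (freeGroup A)
  (@fg_mulA A) (@fg_mul1 A) (@fg_mulr1 A) (@fg_mulV A) (@fg_mulrV A).

Definition fgen (A : choiceType) (a : A) : freeGroup A :=
  @FreeGroup A [:: inl a] isT.

Definition letter_val (A : Type) (G : groupType) (f : A -> G) (l : A + A) : G :=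
  match l with inl a => f a | inr a => (f a)^-1 end.

Definition word_val (A : Type) (G : groupType) (f : A -> G)
  (w : seq (A + A)) : G := \prod_(l <- w) letter_val f l.

Lemma word_val_fgen (A : choiceType) (x : freeGroup A) :
  word_val (@fgen A) x = x.
Proof.
case: x => w rw; apply: val_inj => /=.
rewrite -[RHS](foldr_push_nil rw) {rw} /word_val.
elim: w => [|l w IHw]; first by rewrite big_nil.
by rewrite big_cons /= -IHw; case: l.
Qed.

Lemma word_val_mul (A : choiceType) (G : groupType) (f : A -> G)
  (x y : freeGroup A) : word_val f (x * y) = word_val f x * word_val f y.
Proof.
have val_push l w : word_val f (push l w) = letter_val f l * word_val f w.
  rewrite /word_val; case: w => [|k w] /=; first by rewrite big_cons.
  case: eqP => [->|_]; rewrite !big_cons// mulgA.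
  by case: l => a /=; rewrite ?mulgV ?mulVg mul1g.
case: x => w rw /=; elim: w {rw} => [|l w IHw] /=.
  by rewrite {2}/word_val big_nil mul1g.
by rewrite val_push IHw {3}/word_val big_cons mulgA.
Qed.

Lemma freeGroup_universal (A : choiceType) (G : groupType) (f : A -> G) :
  exists! phi : freeGroup A -> G,
    {morph phi : x y / x * y} /\ forall a, phi (fgen a) = f a.
Proof.
exists (fun x : freeGroup A => word_val f x); split=> [|phi [phiM phif]].
  split=> [x y|a]; first exact: word_val_mul.
  by rewrite /word_val big_seq1.
have phi1 : phi 1 = 1 by apply: (mulgI (phi 1)); rewrite -phiM !mulg1.
have phiV x : phi x^-1 = (phi x)^-1.
  by apply: (mulgI (phi x)); rewrite -phiM !mulgV phi1.
apply/funext => x; rewrite -[in RHS](word_val_fgen x) /word_val.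
rewrite (big_morph phi phiM phi1); apply: eq_bigr => -[a|a] _ /=.
  by rewrite phif.
by rewrite phiV phif.
Qed.

Definition generated (G : groupType) (S : set G) : set G :=
  smallest [set H : set G | group_closed (mem H)] S.

Definition right_coset (G : groupType) (H : set G) (g : G) : set G :=
  [set h * g | h in H].

Definition right_cosets (G : groupType) (H : set G) : set (set G) :=
  range (right_coset H).

Definition finite_index (G : groupType) (H : set G) : Prop :=
  finite_set (right_cosets H).

Definition has_index (G : groupType) (H : set G) (n : nat) : Prop :=
  right_cosets H #= `I_n.

Definition coset_transversal (G : groupType) (H : set G) (I : Type) (g : I -> G) :
  Prop :=
  trivIset [set: I] (fun i => right_coset H (g i)) /\
  \bigcup_i right_coset H (g i) = [set: G].

(** Programs for the partial recursive functions of arity [n]. [Mu g] searches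
    for the least zero of [g] in its first argument. *)
Inductive recfun : nat -> Type :=
| Zero n : recfun n
| Succ : recfun 1
| Proj n (i : 'I_n) : recfun n
| Comp m n (g : recfun m) (h : 'I_m -> recfun n) : recfun n
| Rec n (g : recfun n) (h : recfun n.+2) : recfun n.+1
| Mu n (g : recfun n.+1) : recfun n.

(** [eval f v r]: the program [f] halts on the input [v] with output [r]. *)
Fixpoint eval n (f : recfun n) : n.-tuple nat -> nat -> Prop :=
  match f in recfun n return n.-tuple nat -> nat -> Prop with
  | Zero n => fun _ r => r = 0
  | Succ => fun v r => r = (thead v).+1
  | Proj n i => fun v r => r = tnth v i
  | Comp m n g h => fun v r =>
      exists2 w : m.-tuple nat,
        forall i, eval (h i) v (tnth w i) & eval g w r
  | Rec n g h => fun v =>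
      let v' : n.-tuple nat := [tuple of behead v] in
      (fix loop k r := if k is k'.+1
         then exists2 r', loop k' r' & eval h [tuple of k' :: r' :: v'] r
         else eval g v' r) (thead v)
  | Mu n g => fun v r =>
      eval g [tuple of r :: v] 0 /\
      forall k, k < r -> exists s, eval g [tuple of k :: v] s.+1
  end.

Lemma eval_inj n (f : recfun n) v r s : eval f v r -> eval f v s -> r = s.
Proof.
elim: f v r s => {n} [n||n i|m n g IHg h IHh|n g IHg h IHh|n g IHg] v r s /=.
- by move=> -> ->.
- by move=> -> ->.
- by move=> -> ->.
- move=> [w hw gw] [w' hw' gw']; apply: (IHg w) => //.
  suff -> : w = w' by [].
  by apply: eq_from_tnth => i; apply: IHh (hw i) (hw' i).
- elim: (thead v) r s => [|k IHk] r s; first exact: IHg.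
  by move=> [r' /IHk er hr] [s' /er <-]; apply: IHh.
- move=> [gr ltr] [gs lts]; case: (ltngtP r s) => // [/lts|/ltr] [t gt].
    by have := IHg _ _ _ gr gt.
  by have := IHg _ _ _ gs gt.
Qed.

(** Inputs and outputs are coded by natural numbers through [pickle]. This is
    the usual notion of computability when the coding is effective, which is
    the case of the codings built by the library from those of finite types,
    [nat], pairs, sums, options, sequences and decidable subtypes; the coding
    of a finite type is irrelevant, being a finite table. *)
Definition computable (X Y : countType) (f : X -> Y) : Prop :=
  exists p : recfun 1, forall x, eval p [tuple pickle x] (pickle (f x)).

(* Main.v *)
(** Two prefixes [p], [q] of the generators (prolonged by at most one letter)
    lie in the same coset of [H] if and only if [0 p = 0 q] in every action of
    the free group on [N] points, [N] the number of such words, in which the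
    generators fix [0]: as in M. Hall's theorem, the partial action of the
    letters on the cosets of these words extends to permutations of [N] points.
    There are finitely many actions to inspect, so this is decidable.

    [H] has finite index if and only if the cosets of the prefixes of the
    generators are stable under all letters, and then they are all the cosets.
    For if a letter [l] leads from the coset [H p] out of these cosets, consider
    the covering of the coset graph with group [Z] which counts the crossings of
    that edge. The generators do not cross it, so [H] fixes the base point of
    the covering; but if the index were finite, some [p l^k p^-1] with [k > 0]
    would lie in [H], and its loop crosses the edge at least once, always in the
    same direction. *)

Require Import Defs.
From HB Require Import structures.
From mathcomp Require Import all_boot order perm ssralg ssrnum ssrint.
From mathcomp Require Import boolp classical_sets cardinality.

Local Open Scope classical_set_scope.

Set Implicit Arguments.
Unset Strict Implicit.
Unset Printing Implicit Defensive.

(** * Recursive functions *)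

(** Lists in place of tuples keep the arity out of the types, so that composition needs no casts.
    The program must halt on every input of length [n]. *)
Definition recursive n (F : seq nat -> nat) : Prop :=
  exists p : recfun n, forall v : n.-tuple nat, eval p v (F v).

Lemma recursive_zero n : recursive n (fun=> 0).
Proof. by exists (Zero n). Qed.

Lemma recursive_proj n i : i < n -> recursive n (fun v => nth 0 v i).
Proof.
by move=> lt_in; exists (Proj (Ordinal lt_in)) => v /=; rewrite (tnth_nth 0).
Qed.

Lemma recursive_comp m n (F : seq nat -> nat) (Gs : seq (seq nat -> nat)) :
  recursive m F -> size Gs = m ->
  (forall i, i < m -> recursive n (nth (fun=> 0) Gs i)) ->
  recursive n (fun v => F [seq G v | G <- Gs]).
Proof.
move=> [p pF] sGs rGs.
have /choice[q qG] (i : 'I_m) : exists q : recfun n,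
    forall v : n.-tuple nat, eval q v (nth (fun=> 0) Gs i v) by exact: rGs.
exists (Comp p q) => v.
have sw : size [seq (G : seq nat -> nat) v | G <- Gs] == m.
  by rewrite size_map sGs.
exists (Tuple sw); last exact: (pF (Tuple sw)).
by move=> i; rewrite (tnth_nth 0) (nth_map (fun=> 0)) ?sGs.
Qed.

Lemma recursive_rec n (G H : seq nat -> nat) :
  recursive n G -> recursive n.+2 H ->
  recursive n.+1 (fun v => nat_rect (fun=> nat) (G (behead v))
    (fun k r => H [:: k, r & behead v]) (nth 0 v 0)).
Proof.
move=> [p pG] [q qH]; exists (Rec p q) => v /=.
have -> : thead v = nth 0 v 0 by rewrite [LHS](tnth_nth 0).
elim: (nth 0 v 0) => [|k IHk] /=; first exact: (pG [tuple of behead v]).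
eexists; first exact: IHk.
exact: (qH [tuple of k :: _ :: [tuple of behead v]]).
Qed.

Lemma recursive_mu n (F G : seq nat -> nat) :
  recursive n.+1 F -> (forall v, F (G v :: v) = 0) ->
  (forall v k, k < G v -> 0 < F (k :: v)) -> recursive n G.
Proof.
move=> [p pF] F0 Fpos; exists (Mu p) => v; split=> [|k kG].
  by rewrite -(F0 v); apply: (pF [tuple of G v :: v]).
exists (F (k :: v)).-1; rewrite prednK ?Fpos//.
exact: (pF [tuple of k :: v]).
Qed.

Definition recursive1 F := recursive 1 (fun v => F (nth 0 v 0)).
Definition recursive2 F := recursive 2 (fun v => F (nth 0 v 0) (nth 0 v 1)).
Definition recursive3 F :=
  recursive 3 (fun v => F (nth 0 v 0) (nth 0 v 1) (nth 0 v 2)).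

Lemma recursive_comp1 n (F : nat -> nat) (G : seq nat -> nat) :
  recursive1 F -> recursive n G -> recursive n (fun v => F (G v)).
Proof. by move=> rF rG; apply: (recursive_comp (Gs := [:: G]) rF) => // -[]. Qed.

Lemma recursive_comp2 n (F : nat -> nat -> nat) (G H : seq nat -> nat) :
  recursive2 F -> recursive n G -> recursive n H ->
  recursive n (fun v => F (G v) (H v)).
Proof.
move=> rF rG rH.
by apply: (recursive_comp (Gs := [:: G; H]) rF) => // -[|[|]].
Qed.

Lemma recursive_comp3 n (F : nat -> nat -> nat -> nat) (G H K : seq nat -> nat) :
  recursive3 F -> recursive n G -> recursive n H -> recursive n K ->
  recursive n (fun v => F (G v) (H v) (K v)).
Proof.
move=> rF rG rH rK.
by apply: (recursive_comp (Gs := [:: G; H; K]) rF) => // -[|[|[|]]].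
Qed.

Lemma recursive_ext n (F G : seq nat -> nat) :
  F =1 G -> recursive n F -> recursive n G.
Proof. by move=> /funext ->. Qed.

Lemma recursive_succ : recursive1 succn.
Proof. by exists Succ => v /=; rewrite -(tnth_nth 0 v ord0). Qed.

Lemma recursive_const n c : recursive n (fun=> c).
Proof.
elim: c => [|c IHc]; first exact: recursive_zero.
exact: (recursive_comp1 recursive_succ IHc).
Qed.

Lemma recursive_pred : recursive1 predn.
Proof.
have := recursive_rec (recursive_zero 0) (@recursive_proj 2 0 isT).
by apply: recursive_ext => v /=; case: (nth 0 v 0).
Qed.

Lemma recursive_double : recursive1 double.
Proof.
have rH : recursive 2 (fun v => (nth 0 v 1).+2).
  do 2!apply: (recursive_comp1 recursive_succ); exact: recursive_proj.
have := recursive_rec (recursive_zero 0) rH.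
by apply: recursive_ext => v /=; elim: (nth 0 v 0) => //= k ->.
Qed.

Lemma recursive_sub : recursive2 subn.
Proof.
have rH : recursive 3 (fun v => (nth 0 v 1).-1).
  by apply: (recursive_comp1 recursive_pred); apply: recursive_proj.
have rsub := recursive_rec (@recursive_proj 1 0 isT) rH.
(* [Rec] recurses on the first argument, so iterating [predn] gives subtraction with its arguments
   exchanged. *)
have rsubC : recursive2 (fun a b => b - a).
  apply: recursive_ext rsub => v; rewrite -nth_behead.
  by elim: (nth 0 v 0) => [|k /= ->] /=; rewrite ?subn0// subnS.
by apply: (recursive_comp2 rsubC); apply: recursive_proj.
Qed.

Definition ifpos (c a b : nat) := if c is 0 then b else a.

Lemma recursive_ifpos : recursive3 ifpos.
Proof.
have := recursive_rec (@recursive_proj 2 1 isT) (@recursive_proj 4 2 isT).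
by apply: recursive_ext => v /=; rewrite -!nth_behead /ifpos; case: (nth 0 v 0).
Qed.

(** In the library's coding of sequences, the code of the sequence with head [n] and tail coded by
    [m]; the empty sequence has code 0. *)
Definition consn n m := 2 ^ n * m.*2.+1.

Lemma recursive_consn : recursive2 consn.
Proof.
have rG : recursive 1 (fun v => (nth 0 v 0).*2.+1).
  apply: (recursive_comp1 recursive_succ); exact: recursive_double.
have rH : recursive 3 (fun v => (nth 0 v 1).*2).
  by apply: (recursive_comp1 recursive_double); apply: recursive_proj.
have := recursive_rec rG rH.
apply: recursive_ext => v /=; rewrite /consn -[nth 0 v 1]nth_behead.
elim: (nth 0 v 0) => [|k /= ->]; first by rewrite mul1n.
by rewrite expnS -mulnA mul2n.
Qed.

Lemma consn_code n m : consn n m = CodeSeq.code (n :: CodeSeq.decode m).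
Proof. by rewrite /= CodeSeq.decodeK. Qed.

Lemma consn_inj n m n' m' : consn n m = consn n' m' -> n = n' /\ m = m'.
Proof.
rewrite !consn_code => /(can_inj CodeSeq.codeK)[-> /(congr1 CodeSeq.code)].
by rewrite !CodeSeq.decodeK.
Qed.

Lemma leq_consnr n m : m <= consn n m.
Proof.
apply: (@leq_trans m.*2.+1); first by rewrite -addnn leqW// leq_addr.
by rewrite leq_pmull// expn_gt0.
Qed.

(* The codes of nonempty sequences are the positive numbers, whence the
   shift by one. *)
Definition headn c := head 0 (CodeSeq.decode c.+1).
Definition tailn c := CodeSeq.code (behead (CodeSeq.decode c.+1)).

Lemma consn_headn_tailn c : consn (headn c) (tailn c) = c.+1.
Proof.
rewrite /headn /tailn consn_code CodeSeq.codeK -[RHS]CodeSeq.decodeK.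
by case: CodeSeq.decode (CodeSeq.decodeK c.+1).
Qed.

(** Inverts [consn n] by a search that needs only comparisons; the witness [c.+1] shows that it
    ends. *)
Definition tail_search n c :=
  ex_minn (ex_intro (fun m => c < consn n m) c.+1 (leq_consnr n c.+1)).

(** [consn n] is strictly increasing, so no smaller argument reaches [c.+1]. *)
Lemma tail_searchP n c m :
  consn n m = c.+1 -> tail_search n c = m.
Proof.
rewrite /tail_search; case: ex_minnP => m' ltc minm e.
apply/eqP; rewrite eqn_leq minm ?e//= leqNgt; apply/negP => ltmm.
suff: consn n m' < consn n m by rewrite e ltnS leqNgt ltc.
by rewrite ltn_pmul2l ?expn_gt0// ltnS ltn_double.
Qed.

Lemma recursive_tail_search : recursive2 tail_search.
Proof.
apply: (recursive_mu
  (F := fun v => (nth 0 v 2).+1 - consn (nth 0 v 1) (nth 0 v 0))).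
- apply: (recursive_comp2 recursive_sub).
    by apply: (recursive_comp1 recursive_succ); apply: recursive_proj.
  by apply: (recursive_comp2 recursive_consn); apply: recursive_proj.
- move=> v /=.
  by rewrite /tail_search; case: ex_minnP => m lt _; apply/eqP; rewrite subn_eq0.
- move=> v k; rewrite /= subn_gt0.
  rewrite /tail_search; case: ex_minnP => m _ minm.
  move=> ltkm; rewrite ltnS leqNgt; apply: contraL ltkm => /minm.
  by rewrite -leqNgt.
Qed.

Lemma recursive_headn : recursive1 headn.
Proof.
(* With [k] and [c] as first two arguments, [tail_search k c] is the only candidate for a tail if
   the head is [k]. The excess over [c.+1] vanishes only at the head, by injectivity of [consn]. *)
pose F v :=
  consn (nth 0 v 0) (tail_search (nth 0 v 0) (nth 0 v 1)) - (nth 0 v 1).+1.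
have hd_ge v k : k <= headn (nth 0 v 0) -> (F (k :: v) == 0) =
    (k == headn (nth 0 v 0)).
  move=> kh; rewrite /F /=; set c := nth 0 v 0 in kh *.
  rewrite subn_eq0; apply/idP/eqP => [lec|->].
    have : consn k (tail_search k c) = c.+1.
      apply/eqP; rewrite eqn_leq lec; rewrite /tail_search.
      by case: ex_minnP.
    by rewrite -[in RHS](consn_headn_tailn c) => /consn_inj[].
  by rewrite (tail_searchP (consn_headn_tailn c)) consn_headn_tailn.
apply: (recursive_mu (F := F)).
- apply: (recursive_comp2 recursive_sub).
    apply: (recursive_comp2 recursive_consn); first exact: recursive_proj.
    by apply: (recursive_comp2 recursive_tail_search); apply: recursive_proj.
  by apply: (recursive_comp1 recursive_succ); apply: recursive_proj.
- by move=> v; apply/eqP; rewrite hd_ge.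
- by move=> v k lt; rewrite lt0n hd_ge ?neq_ltn ?lt// ltnW.
Qed.

Lemma recursive_tailn : recursive1 tailn.
Proof.
have : recursive 1 (fun v => tail_search (headn (nth 0 v 0)) (nth 0 v 0)).
  apply: (recursive_comp2 recursive_tail_search); last exact: recursive_proj.
  exact: recursive_headn.
apply: recursive_ext => v; exact: tail_searchP (consn_headn_tailn _).
Qed.

Lemma headn_consn n m : headn (consn n m).-1 = n.
Proof. by rewrite /headn prednK ?muln_gt0 ?expn_gt0// consn_code CodeSeq.codeK. Qed.

Lemma tailn_consn n m : tailn (consn n m).-1 = m.
Proof.
rewrite /tailn prednK ?muln_gt0 ?expn_gt0// consn_code CodeSeq.codeK.
exact: CodeSeq.decodeK.
Qed.

(** * Total computability over countable types *)

(* Unlike [computable], this asks for a program that halts on every natural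
   number, so that it may be run on numbers which code nothing. *)
Definition tcomputable (X Y : countType) (f : X -> Y) : Prop :=
  exists2 F, recursive1 F & forall x, F (pickle x) = pickle (f x).

Lemma computable_of_total (X Y : countType) (f : X -> Y) :
  tcomputable f -> computable f.
Proof.
by move=> [F [p pF] Ff]; exists p => x; rewrite -Ff; apply: (pF [tuple pickle x]).
Qed.

Section Lifting.
Variables X Y Z W V : countType.

Lemma tcomputable_ext (f g : X -> Y) : f =1 g -> tcomputable f -> tcomputable g.
Proof. by move=> /funext ->. Qed.

Lemma tcomputable_id : tcomputable (fun x : X => x).
Proof. by exists id => //; apply: recursive_proj. Qed.

Lemma tcomputable_cst (y : Y) : tcomputable (fun _ : X => y).
Proof. by exists (fun=> pickle y) => //; apply: recursive_const. Qed.

Lemma tcomputable_comp (g : Y -> Z) (f : X -> Y) :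
  tcomputable g -> tcomputable f -> tcomputable (fun x => g (f x)).
Proof.
move=> [G rG Gg] [F rF Ff]; exists (fun c => G (F c)) => [|x].
  exact: (recursive_comp1 rG).
by rewrite Ff Gg.
Qed.

Lemma tcomputable_lift1 F (f : X -> Y) (g : X -> Z) :
  recursive1 F -> (forall x, pickle (g x) = F (pickle (f x))) ->
  tcomputable f -> tcomputable g.
Proof.
move=> rF Fg [G rG Gf]; exists (fun c => F (G c)) => [|x].
  exact: (recursive_comp1 rF).
by rewrite Fg Gf.
Qed.

Lemma tcomputable_lift2 F (f : X -> Y) (g : X -> Z) (h : X -> W) :
  recursive2 F -> (forall x, pickle (h x) = F (pickle (f x)) (pickle (g x))) ->
  tcomputable f -> tcomputable g -> tcomputable h.
Proof.
move=> rF Fh [G rG Gf] [H rH Hg]; exists (fun c => F (G c) (H c)) => [|x].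
  exact: (recursive_comp2 rF).
by rewrite Fh Gf Hg.
Qed.

Lemma tcomputable_lift3 F (f : X -> Y) (g : X -> Z) (h : X -> W) (k : X -> V) :
  recursive3 F ->
  (forall x, pickle (k x) = F (pickle (f x)) (pickle (g x)) (pickle (h x))) ->
  tcomputable f -> tcomputable g -> tcomputable h -> tcomputable k.
Proof.
move=> rF Fk [G rG Gf] [H rH Hg] [K rK Kh].
exists (fun c => F (G c) (H c) (K c)) => [|x]; first exact: (recursive_comp3 rF).
by rewrite Fk Gf Hg Kh.
Qed.

End Lifting.

(** A pair is pickled as the two-element sequence of its codes. *)
Definition pairn a b := consn a (consn b 0).

Lemma recursive_pairn : recursive2 pairn.
Proof.
apply: (recursive_comp2 recursive_consn); first exact: recursive_proj.
apply: (recursive_comp2 recursive_consn); first exact: recursive_proj.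
exact: recursive_const.
Qed.

Lemma pickle_pair (X Y : countType) (x : X) (y : Y) :
  pickle (x, y) = pairn (pickle x) (pickle y).
Proof. by []. Qed.

Lemma pickle_cons (X : countType) (x : X) (s : seq X) :
  pickle (x :: s) = consn (pickle x) (pickle s).
Proof. by []. Qed.

Lemma pickle_bool (b : bool) : pickle b = b.
Proof. by []. Qed.

Section Combinators.
Variables X Y Z : countType.

Lemma tcomputable_pair (f : X -> Y) (g : X -> Z) :
  tcomputable f -> tcomputable g -> tcomputable (fun x => (f x, g x)).
Proof. exact: (tcomputable_lift2 recursive_pairn). Qed.

Lemma tcomputable_fst (f : X -> Y * Z) :
  tcomputable f -> tcomputable (fun x => (f x).1).
Proof.
apply: (@tcomputable_lift1 _ _ _ (fun c => headn c.-1)).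
  exact: (recursive_comp1 recursive_headn recursive_pred).
by move=> x; case: (f x) => y z; rewrite pickle_pair headn_consn.
Qed.

Lemma tcomputable_snd (f : X -> Y * Z) :
  tcomputable f -> tcomputable (fun x => (f x).2).
Proof.
apply: (@tcomputable_lift1 _ _ _ (fun c => headn (tailn c.-1).-1)).
  apply: (recursive_comp1 recursive_headn).
  apply: (recursive_comp1 recursive_pred).
  exact: (recursive_comp1 recursive_tailn recursive_pred).
by move=> x; case: (f x) => y z; rewrite pickle_pair tailn_consn headn_consn.
Qed.

Lemma tcomputable_cons (f : X -> Y) (s : X -> seq Y) :
  tcomputable f -> tcomputable s -> tcomputable (fun x => f x :: s x).
Proof. exact: (tcomputable_lift2 recursive_consn). Qed.

Lemma tcomputable_Some (f : X -> Y) :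
  tcomputable f -> tcomputable (fun x => Some (f x)).
Proof.
(* [Some y] is pickled as a one-element sequence. *)
apply: (@tcomputable_lift1 _ _ _ (fun c => consn c 0)) => //.
apply: (recursive_comp2 recursive_consn); last exact: recursive_const.
exact: recursive_proj.
Qed.

End Combinators.

Section Control.
Variables X Y Z : countType.

Lemma tcomputable_if (b : X -> bool) (f g : X -> Y) :
  tcomputable b -> tcomputable f -> tcomputable g ->
  tcomputable (fun x => if b x then f x else g x).
Proof.
by apply: (tcomputable_lift3 recursive_ifpos) => x; rewrite pickle_bool; case: b.
Qed.

Lemma tcomputable_succ (f : X -> nat) :
  tcomputable f -> tcomputable (fun x => (f x).+1).
Proof. exact: (tcomputable_lift1 recursive_succ). Qed.

Lemma tcomputable_eq (f g : X -> Y) :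
  tcomputable f -> tcomputable g -> tcomputable (fun x => f x == g x).
Proof.
(* [pickle] is injective, so equality is tested on codes: both truncated differences must vanish. *)
apply: (@tcomputable_lift2 _ _ _ _
  (fun a b => ifpos (a - b) 0 (ifpos (b - a) 0 1))).
  have r1 := @recursive_proj 2 0 isT; have r2 := @recursive_proj 2 1 isT.
  apply: (recursive_comp3 recursive_ifpos).
  - exact: (recursive_comp2 recursive_sub).
  - exact: recursive_const.
  apply: (recursive_comp3 recursive_ifpos).
  - exact: (recursive_comp2 recursive_sub).
  - exact: recursive_const.
  - exact: recursive_const.
move=> x; rewrite pickle_bool -(inj_eq (pcan_inj pickleK)).
set a := pickle _; set b := pickle _; rewrite eqn_leq -!subn_eq0.
by case: (a - b) => //; case: (b - a).
Qed.

Lemma tcomputable_natrec (n : X -> nat) (g : X -> Y) (h : X -> nat -> Y -> Y) :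
  tcomputable n -> tcomputable g ->
  tcomputable (fun p : X * nat * Y => h p.1.1 p.1.2 p.2) ->
  tcomputable (fun x => nat_rect (fun=> Y) (g x) (h x) (n x)).
Proof.
move=> [N rN Nn] [G rG Gg] [H rH Hh].
pose F a c := nat_rect (fun=> nat) (G c) (fun k r => H (pairn (pairn c k) r)) a.
have rF : recursive2 F.
  have rK : recursive 3 (fun v =>
      H (pairn (pairn (nth 0 v 2) (nth 0 v 0)) (nth 0 v 1))).
    apply: (recursive_comp1 rH).
    apply: (recursive_comp2 recursive_pairn); last exact: recursive_proj.
    by apply: (recursive_comp2 recursive_pairn); apply: recursive_proj.
  have := recursive_rec rG rK; apply: recursive_ext => v.
  by rewrite /F -[nth 0 v 1]nth_behead.
exists (fun c => F (N c) c) => [|x].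
  exact: (recursive_comp2 rF rN (@recursive_proj 1 0 isT)).
rewrite Nn /F; elim: (n x) => [|k /= ->]; first exact: Gg.
by rewrite -(Hh (x, k, _)) !pickle_pair.
Qed.

Lemma tcomputable_seqcase (s : X -> seq Z) (g : X -> Y)
    (h : X -> Z -> seq Z -> Y) :
  tcomputable s -> tcomputable g ->
  tcomputable (fun p : X * Z * seq Z => h p.1.1 p.1.2 p.2) ->
  tcomputable (fun x => if s x is z :: r then h x z r else g x).
Proof.
move=> [S rS Ss] [G rG Gg] [H rH Hh].
(* A sequence is nonempty exactly when its code is positive. Both branches are evaluated before
   [ifpos] selects one, so [H] also runs on the meaningless pieces of an empty sequence: hence the
   need for total programs. *)
exists (fun c => ifpos (S c)
    (H (pairn (pairn c (headn (S c).-1)) (tailn (S c).-1))) (G c)) => [|x].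
  have rP : recursive1 (fun c => (S c).-1) := recursive_comp1 recursive_pred rS.
  apply: (recursive_comp3 recursive_ifpos) => //; apply: (recursive_comp1 rH).
  apply: (recursive_comp2 recursive_pairn).
    apply: (recursive_comp2 recursive_pairn); first exact: recursive_proj.
    exact: (recursive_comp1 recursive_headn rP).
  exact: (recursive_comp1 recursive_tailn rP).
rewrite Ss; case: (s x) => [|z r] /=; first exact: Gg.
rewrite pickle_cons headn_consn tailn_consn -(Hh (x, z, r)) !pickle_pair.
have : 0 < consn (pickle z) (pickle r) by rewrite muln_gt0 expn_gt0.
by case: consn.
Qed.

End Control.

(** Provides fuel: a loop run as many times as the code of a list exhausts the list. *)
Lemma size_pickle (X : countType) (s : seq X) : size s <= pickle s.
Proof.
elim: s => //= x s IHs; rewrite pickle_cons.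
apply: (@leq_trans (pickle s).*2.+1).
  by rewrite ltnS -addnn (leq_trans IHs) ?leq_addr.
by rewrite leq_pmull// expn_gt0.
Qed.

(** * Loops over sequences *)

Section SeqCombinators.
Variables X Y Z W : countType.

Lemma tcomputable_foldl (f : X -> Y -> Z -> Y) (g : X -> Y) (s : X -> seq Z) :
  tcomputable (fun p : X * Y * Z => f p.1.1 p.1.2 p.2) -> tcomputable g ->
  tcomputable s -> tcomputable (fun x => foldl (f x) (g x) (s x)).
Proof.
move=> cf cg cs.
(* One turn consumes one element and is stationary on the empty list, so [pickle (s x)] turns give
   the same result as [size (s x)] turns. *)
pose step x (st : Y * seq Z) :=
  if st.2 is z :: r then (f x st.1 z, r) else st.
have stepE x y r n : size r <= n -> (iter n (step x) (y, r)).1 = foldl (f x) y r.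
  elim: n y r => [|n IHn] y [|z r]//.
    by rewrite iterSr IHn.
  by move=> lt; rewrite iterSr IHn.
have cs' : tcomputable (fun x => pickle (s x)).
  by case: cs => S rS Ss; exists S.
have : tcomputable (fun x => (nat_rect (fun=> Y * seq Z)%type (g x, s x)
    (fun _ st => step x st) (pickle (s x))).1).
  apply: tcomputable_fst; apply: tcomputable_natrec => //.
    exact: tcomputable_pair.
  apply: tcomputable_seqcase.
  - by do 2!apply: tcomputable_snd; apply: tcomputable_id.
  - by apply: tcomputable_snd; apply: tcomputable_id.
  apply: tcomputable_pair; last by apply: tcomputable_snd; apply: tcomputable_id.
  apply: (tcomputable_comp (f := fun p : X * nat * (Y * seq Z) * Z * seq Z =>
    (p.1.1.1.1, p.1.1.2.1, p.1.2)) cf).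
  apply: tcomputable_pair; last first.
    by apply/tcomputable_snd/tcomputable_fst/tcomputable_id.
  apply: tcomputable_pair.
    by do 4!apply: tcomputable_fst; apply: tcomputable_id.
  apply: tcomputable_fst; apply: tcomputable_snd.
  by do 2!apply: tcomputable_fst; apply: tcomputable_id.
apply: tcomputable_ext => x; rewrite -(stepE x _ _ _ (size_pickle (s x))).
by congr _.1; elim: pickle => //= n ->.
Qed.

End SeqCombinators.

Lemma tcomputable_app2 (X Y Z W : countType) (h : Y -> Z -> W)
    (f : X -> Y) (g : X -> Z) :
  tcomputable (fun p : Y * Z => h p.1 p.2) -> tcomputable f -> tcomputable g ->
  tcomputable (fun x => h (f x) (g x)).
Proof.
move=> ch cf cg.
exact: (tcomputable_comp ch (tcomputable_pair cf cg)).
Qed.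

Lemma tcomputable_app3 (X Y Z W V : countType) (h : Y -> Z -> W -> V)
    (f : X -> Y) (g : X -> Z) (k : X -> W) :
  tcomputable (fun p : Y * Z * W => h p.1.1 p.1.2 p.2) ->
  tcomputable f -> tcomputable g -> tcomputable k ->
  tcomputable (fun x => h (f x) (g x) (k x)).
Proof.
move=> ch cf cg ck.
exact: (tcomputable_comp ch (tcomputable_pair (tcomputable_pair cf cg) ck)).
Qed.

(** Variables in scope are carried as nested pairs, so that a reference to one of them is a chain of
    projections. *)
Ltac tc_var :=
  repeat first [exact: tcomputable_id | apply: tcomputable_fst
               | apply: tcomputable_snd].

Section Foldr.
Variables X Y Z : countType.

Lemma tcomputable_rev (s : X -> seq Z) :
  tcomputable s -> tcomputable (fun x => rev (s x)).
Proof.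
move=> cs.
have : tcomputable (fun x => foldl (fun acc z => z :: acc) [::] (s x)).
  apply: tcomputable_foldl => //; last exact: tcomputable_cst.
  by apply: tcomputable_cons; tc_var.
apply: tcomputable_ext => x; rewrite -[s x in LHS]revK foldl_rev.
by elim: (rev _) => //= z r ->.
Qed.

Lemma tcomputable_foldr (f : X -> Z -> Y -> Y) (g : X -> Y) (s : X -> seq Z) :
  tcomputable (fun p : X * Z * Y => f p.1.1 p.1.2 p.2) -> tcomputable g ->
  tcomputable s -> tcomputable (fun x => foldr (f x) (g x) (s x)).
Proof.
move=> cf cg cs.
have : tcomputable (fun x => foldl (fun y z => f x z y) (g x) (rev (s x))).
  apply: tcomputable_foldl => //; last exact: tcomputable_rev.
  by apply: (tcomputable_app3 cf); tc_var.
by apply: tcomputable_ext => x; rewrite foldl_rev.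
Qed.

End Foldr.

Section SeqTheory.
Variables X Y Z : countType.

Lemma tcomputable_map (f : X -> Z -> Y) (s : X -> seq Z) :
  tcomputable (fun p : X * Z => f p.1 p.2) -> tcomputable s ->
  tcomputable (fun x => map (f x) (s x)).
Proof.
move=> cf cs.
have : tcomputable (fun x => foldr (fun z acc => f x z :: acc) [::] (s x)).
  apply: tcomputable_foldr => //; last exact: tcomputable_cst.
  apply: tcomputable_cons; last by tc_var.
  by apply: (tcomputable_app2 cf); tc_var.
by apply: tcomputable_ext => x; elim: (s x) => //= z r ->.
Qed.

Lemma tcomputable_has (a : X -> pred Z) (s : X -> seq Z) :
  tcomputable (fun p : X * Z => a p.1 p.2) -> tcomputable s ->
  tcomputable (fun x => has (a x) (s x)).
Proof.
move=> ca cs.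
have : tcomputable (fun x =>
    foldr (fun z b => if a x z then true else b) false (s x)).
  apply: tcomputable_foldr => //; last exact: tcomputable_cst.
  apply: tcomputable_if; [|exact: tcomputable_cst|by tc_var].
  by apply: (tcomputable_app2 ca); tc_var.
by apply: tcomputable_ext => x; elim: (s x) => //= z r ->.
Qed.

Lemma tcomputable_all (a : X -> pred Z) (s : X -> seq Z) :
  tcomputable (fun p : X * Z => a p.1 p.2) -> tcomputable s ->
  tcomputable (fun x => all (a x) (s x)).
Proof.
move=> ca cs.
have : tcomputable (fun x =>
    foldr (fun z b => if a x z then b else false) true (s x)).
  apply: tcomputable_foldr => //; last exact: tcomputable_cst.
  apply: tcomputable_if; [|by tc_var|exact: tcomputable_cst].
  by apply: (tcomputable_app2 ca); tc_var.
by apply: tcomputable_ext => x; elim: (s x) => //= z r ->.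
Qed.

Lemma tcomputable_cat (s t : X -> seq Z) :
  tcomputable s -> tcomputable t -> tcomputable (fun x => s x ++ t x).
Proof.
move=> cs ct.
have : tcomputable (fun x => foldr (fun z acc => z :: acc) (t x) (s x)).
  by apply: tcomputable_foldr => //; apply: tcomputable_cons; tc_var.
by apply: tcomputable_ext => x; elim: (s x) => //= z r ->.
Qed.

Lemma tcomputable_size (s : X -> seq Z) :
  tcomputable s -> tcomputable (fun x => size (s x)).
Proof.
move=> cs.
have : tcomputable (fun x => foldr (fun _ n => n.+1) 0 (s x)).
  apply: tcomputable_foldr => //; last exact: tcomputable_cst.
  by apply: tcomputable_succ; tc_var.
by apply: tcomputable_ext => x; elim: (s x) => //= z r ->.
Qed.

Lemma tcomputable_nth (d : X -> Z) (s : X -> seq Z) (n : X -> nat) :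
  tcomputable d -> tcomputable s -> tcomputable n ->
  tcomputable (fun x => nth (d x) (s x) (n x)).
Proof.
move=> cd cs cn.
pose drp s n := nat_rect (fun=> seq Z) s
  (fun _ r => if r is _ :: r' then r' else [::]) n.
have drpE t k : drp t k = drop k t.
  rewrite /drp; elim: k => [|k IHk] /=; first by rewrite drop0.
  by rewrite IHk -add1n -drop_drop; case: (drop k t) => //= z r; rewrite drop0.
have : tcomputable (fun x => if drp (s x) (n x) is z :: r then z else d x).
  apply: tcomputable_seqcase => //; last by tc_var.
  apply: tcomputable_natrec => //.
  by apply: tcomputable_seqcase; [tc_var|exact: tcomputable_cst|tc_var].
apply: tcomputable_ext => x; rewrite drpE -[n x in RHS]addn0 -nth_drop.
by case: drop.
Qed.

Lemma tcomputable_and (a b : X -> bool) :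
  tcomputable a -> tcomputable b -> tcomputable (fun x => a x && b x).
Proof.
by move=> ca cb; apply: (tcomputable_if ca cb); apply: tcomputable_cst.
Qed.

Lemma tcomputable_implb (a b : X -> bool) :
  tcomputable a -> tcomputable b -> tcomputable (fun x => a x ==> b x).
Proof.
by move=> ca cb; apply: (tcomputable_if ca cb); apply: tcomputable_cst.
Qed.

End SeqTheory.

Lemma tcomputable_flatten (X Z : countType) (s : X -> seq (seq Z)) :
  tcomputable s -> tcomputable (fun x => flatten (s x)).
Proof.
move=> cs; apply: (@tcomputable_foldr _ _ _ (fun=> cat) (fun=> [::])) => //.
  by apply: tcomputable_cat; tc_var.
exact: tcomputable_cst.
Qed.

Lemma tcomputable_rcons (X Z : countType) (s : X -> seq Z) (z : X -> Z) :
  tcomputable s -> tcomputable z -> tcomputable (fun x => rcons (s x) (z x)).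
Proof.
move=> cs cz; apply: (@tcomputable_ext _ _ (fun x => s x ++ [:: z x])) => [x|].
  by rewrite cats1.
by do ![apply: tcomputable_cat|apply: tcomputable_cons|exact: tcomputable_cst] => //.
Qed.

Lemma tcomputable_iota0 (X : countType) (n : X -> nat) :
  tcomputable n -> tcomputable (fun x => iota 0 (n x)).
Proof.
move=> cn.
have : tcomputable (fun x => nat_rect (fun=> seq nat) [::]
    (fun k s => rcons s k) (n x)).
  apply: tcomputable_natrec => //; first exact: tcomputable_cst.
  by apply: tcomputable_rcons; tc_var.
apply: tcomputable_ext => x; elim: (n x) => // k IHk.
by rewrite -[in RHS]addn1 iotaD /= IHk cats1.
Qed.

(** A finite table, realised by comparing the input with the code of each element in turn, with
    value 0 off the table. *)
Lemma tcomputable_fin (T : finType) (Y : countType) (f : T -> Y) : tcomputable f.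
Proof.
have [F rF Ff] : exists2 F, recursive1 F &
    {in enum T, forall t, F (pickle t) = pickle (f t)}.
  elim: (enum T) => [|t0 s [F rF Ff]].
    by exists (fun=> 0) => //; apply: recursive_const.
  exists (fun c => ifpos (c - pickle t0) (F c)
           (ifpos (pickle t0 - c) (F c) (pickle (f t0)))).
    have r1 := @recursive_proj 1 0 isT; have rc := recursive_const 1.
    apply: (recursive_comp3 recursive_ifpos) => //.
      exact: (recursive_comp2 recursive_sub).
    apply: (recursive_comp3 recursive_ifpos) => //.
    exact: (recursive_comp2 recursive_sub).
  move=> t; rewrite inE; case: eqVneq => [->|tt0 /= /Ff <-].
    by rewrite subnn.
  have: pickle t != pickle t0 by rewrite (inj_eq (pcan_inj pickleK)).
  rewrite eqn_leq -!subn_eq0 /ifpos.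
  by case: (pickle t - _) => //; case: (pickle t0 - _).
by exists F => // t; rewrite Ff// mem_enum.
Qed.

(** * The algorithm *)

Section Algorithm.
Variable A : finType.
Local Notation letter := (A + A)%type.
Local Notation word := (seq (A + A)).
Implicit Types (l : letter) (u v w p q : word) (vs : seq word).
Implicit Types (tb : seq (seq nat)).

(** A table has one row per letter, in the order of [enum], listing the images of the points. A
    point beyond the row is fixed, so that a table acts on all of [nat]. *)
Definition step tb l x := nth x (nth [::] tb (index l (enum {: letter}))) x.
Definition run tb w x := foldl (fun y l => step tb l y) x w.

Definition seqs_of (T : Type) (s : seq T) n : seq (seq T) :=
  nat_rect (fun=> seq (seq T)) [:: [::]]
    (fun _ r => flatten [seq [seq z :: t | t <- r] | z <- s]) n.

Definition tables n : seq (seq (seq nat)) :=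
  seqs_of (seqs_of (iota 0 n) n) #|{: letter}|.

Definition is_action n tb : bool :=
  all (fun l => all (fun x => step tb (letter_inv l) (step tb l x) == x)
    (iota 0 n)) (enum {: letter}).

Definition prefixes w : seq word :=
  foldr (fun l r => [::] :: [seq l :: u | u <- r]) [:: [::]] w.

(** The empty word is added so that the coset of the identity is present even without generators;
    standing first, it gets the number 0. *)
Definition gen_prefixes vs : seq word := [::] :: flatten (map prefixes vs).

Definition neighbours vs : seq word := gen_prefixes vs ++
  flatten [seq [seq rcons p l | l <- enum {: letter}] | p <- gen_prefixes vs].

Definition separates vs tb p q : bool :=
  all (fun v => run tb v 0 == 0) vs && (run tb p 0 != run tb q 0).

(** The number of points is that of the words in [neighbours vs]: room enough for one point per
    coset met. *)
Definition same_coset vs p q : bool :=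
  all (fun tb => is_action (size (neighbours vs)) tb ==>
      ~~ separates vs tb p q) (tables (size (neighbours vs))).

Definition closed_prefixes vs : bool :=
  all (fun p => all (fun l => has (same_coset vs (rcons p l)) (gen_prefixes vs))
    (enum {: letter})) (gen_prefixes vs).

(** When [e] is an equivalence on [s], the last member of each class is kept. *)
Definition undup_by (T : Type) (e : rel T) (s : seq T) : seq T :=
  foldr (fun x r => if has (e x) r then r else x :: r) [::] s.

Definition coset_reps vs : seq word :=
  undup_by (same_coset vs) (gen_prefixes vs).

Definition index_algorithm vs : option (nat * seq (freeGroup A)) :=
  if closed_prefixes vs then
    Some (size (coset_reps vs), map (word_val (@fgen A)) (coset_reps vs))
  else None.

(** * Computability of the algorithm *)

Lemma tcomputable_step (X : countType) (tb : X -> seq (seq nat))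
    (l : X -> letter) (x : X -> nat) :
  tcomputable tb -> tcomputable l -> tcomputable x ->
  tcomputable (fun a : X => step (tb a) (l a) (x a)).
Proof.
move=> ct cl cx; apply: tcomputable_nth => //; apply: tcomputable_nth => //.
  exact: tcomputable_cst.
exact: (tcomputable_comp (tcomputable_fin
  (fun l : letter => index l (enum {: letter}))) cl).
Qed.

Lemma tcomputable_run (X : countType) (tb : X -> seq (seq nat))
    (w : X -> word) (x : X -> nat) :
  tcomputable tb -> tcomputable w -> tcomputable x ->
  tcomputable (fun a : X => run (tb a) (w a) (x a)).
Proof.
move=> ct cw cx; apply: (tcomputable_foldl _ cx cw).
apply: tcomputable_step; [|by tc_var..].
by apply: (tcomputable_comp ct); tc_var.
Qed.

Lemma tcomputable_seqs_of (X Z : countType) (s : X -> seq Z) (n : X -> nat) :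
  tcomputable s -> tcomputable n -> tcomputable (fun x => seqs_of (s x) (n x)).
Proof.
move=> cs cn; apply: tcomputable_natrec => //; first exact: tcomputable_cst.
apply: tcomputable_flatten; apply: tcomputable_map; last first.
  by apply: (tcomputable_comp cs); tc_var.
by apply: tcomputable_map; first apply: tcomputable_cons; tc_var.
Qed.

Lemma tcomputable_prefixes : tcomputable prefixes.
Proof.
apply: (tcomputable_foldr (X := seq letter) (s := id)
    (f := fun _ l r => [::] :: [seq l :: u | u <- r])
    (g := fun=> [:: [::]])); [|exact: tcomputable_cst|exact: tcomputable_id].
apply: tcomputable_cons; first exact: tcomputable_cst.
by apply: tcomputable_map; first apply: tcomputable_cons; tc_var.
Qed.

Lemma tcomputable_gen_prefixes : tcomputable gen_prefixes.
Proof.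
apply: tcomputable_cons; first exact: tcomputable_cst.
apply: tcomputable_flatten; apply: (tcomputable_map (f := fun=> prefixes)).
  by apply: (tcomputable_comp tcomputable_prefixes); tc_var.
exact: tcomputable_id.
Qed.

Lemma tcomputable_neighbours : tcomputable neighbours.
Proof.
apply: tcomputable_cat; first exact: tcomputable_gen_prefixes.
apply: tcomputable_flatten; apply: tcomputable_map; last first.
  exact: tcomputable_gen_prefixes.
by apply: tcomputable_map;
  [apply: tcomputable_rcons; tc_var|exact: tcomputable_cst].
Qed.

Lemma tcomputable_tables (X : countType) (n : X -> nat) :
  tcomputable n -> tcomputable (fun x => tables (n x)).
Proof.
move=> cn; apply: tcomputable_seqs_of; last exact: tcomputable_cst.
by apply: tcomputable_seqs_of => //; apply: tcomputable_iota0.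
Qed.

Lemma tcomputable_is_action (X : countType) (n : X -> nat)
    (tb : X -> seq (seq nat)) :
  tcomputable n -> tcomputable tb ->
  tcomputable (fun x => is_action (n x) (tb x)).
Proof.
move=> cn ct; apply: tcomputable_all; last exact: tcomputable_cst.
apply: tcomputable_all; last first.
  by apply: tcomputable_iota0; apply: (tcomputable_comp cn); tc_var.
have ct' : tcomputable (fun p : X * letter * nat => tb p.1.1).
  by apply: (tcomputable_comp ct); tc_var.
apply: tcomputable_eq; last by tc_var.
apply: tcomputable_step => //; last by apply: tcomputable_step => //; tc_var.
by apply: (tcomputable_comp (tcomputable_fin (@letter_inv A))); tc_var.
Qed.

Lemma tcomputable_separates (X : countType) (vs : X -> seq word)
    (tb : X -> seq (seq nat)) (p q : X -> word) :
  tcomputable vs -> tcomputable tb -> tcomputable p -> tcomputable q ->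
  tcomputable (fun x => separates (vs x) (tb x) (p x) (q x)).
Proof.
move=> cvs ct cp cq; apply: tcomputable_and.
  apply: tcomputable_all => //; apply: tcomputable_eq; last exact: tcomputable_cst.
  apply: tcomputable_run; [|by tc_var|exact: tcomputable_cst].
  by apply: (tcomputable_comp ct); tc_var.
apply: (tcomputable_if (f := fun=> false) (g := fun=> true)).
- by apply: tcomputable_eq; apply: tcomputable_run => //;
   apply: tcomputable_cst.
- exact: tcomputable_cst.
- exact: tcomputable_cst.
Qed.

Lemma tcomputable_same_coset (X : countType) (vs : X -> seq word)
    (p q : X -> word) :
  tcomputable vs -> tcomputable p -> tcomputable q ->
  tcomputable (fun x => same_coset (vs x) (p x) (q x)).
Proof.
move=> cvs cp cq.
have cn : tcomputable (fun x => size (neighbours (vs x))).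
  by apply: tcomputable_size; apply: (tcomputable_comp tcomputable_neighbours cvs).
apply: tcomputable_all; last exact: tcomputable_tables.
apply: tcomputable_implb.
  by apply: tcomputable_is_action; [apply: (tcomputable_comp cn)|]; tc_var.
apply: (tcomputable_if (f := fun=> false) (g := fun=> true)).
- apply: tcomputable_separates; last 2 first.
  + by apply: (tcomputable_comp cp); tc_var.
  + by apply: (tcomputable_comp cq); tc_var.
  + by apply: (tcomputable_comp cvs); tc_var.
  + by tc_var.
- exact: tcomputable_cst.
- exact: tcomputable_cst.
Qed.

Lemma tcomputable_closed_prefixes : tcomputable closed_prefixes.
Proof.
apply: tcomputable_all; last exact: tcomputable_gen_prefixes.
apply: tcomputable_all; last exact: tcomputable_cst.
apply: tcomputable_has; last first.
  by apply: (tcomputable_comp tcomputable_gen_prefixes); tc_var.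
apply: tcomputable_same_coset; [by tc_var| |by tc_var].
by apply: tcomputable_rcons; tc_var.
Qed.

Lemma tcomputable_coset_reps : tcomputable coset_reps.
Proof.
rewrite /coset_reps /undup_by.
apply: tcomputable_foldr; last exact: tcomputable_gen_prefixes.
  apply: tcomputable_if; [|by tc_var|by apply: tcomputable_cons; tc_var].
  by apply: tcomputable_has; [apply: tcomputable_same_coset|]; tc_var.
exact: tcomputable_cst.
Qed.

Lemma fword_word_val w : fword (word_val (@fgen A) w) = foldr (@push A) [::] w.
Proof.
rewrite /word_val; elim: w => [|l w IHw]; first by rewrite big_nil.
by rewrite big_cons /= -IHw; case: l.
Qed.

(** An element of the free group is pickled as its reduced word, so it suffices to compute the free
    reduction, a fold of [push]. *)
Lemma tcomputable_word_val (X : countType) (w : X -> word) :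
  tcomputable w -> tcomputable (fun x => word_val (@fgen A) (w x)).
Proof.
move=> cw; have [F rF Ff] : tcomputable (fun x => foldr (@push A) [::] (w x)).
  apply: (tcomputable_foldr (f := fun=> @push A)) => //; last exact: tcomputable_cst.
  have cl (Y : countType) (l : Y -> letter) : tcomputable l ->
      tcomputable (fun y => letter_inv (l y)).
    exact: (tcomputable_comp (tcomputable_fin (@letter_inv A))).
  rewrite /push; apply: tcomputable_seqcase; first by tc_var.
    by apply: tcomputable_cons; [tc_var|exact: tcomputable_cst].
  apply: tcomputable_if; [|by tc_var|by do 2?apply: tcomputable_cons; tc_var].
  by apply: tcomputable_eq; [tc_var|apply: cl; tc_var].
exists F => // x; rewrite Ff -fword_word_val //.
Qed.

Lemma computable_index_algorithm : computable index_algorithm.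
Proof.
apply: computable_of_total; apply: tcomputable_if.
- exact: tcomputable_closed_prefixes.
- apply: tcomputable_Some; apply: tcomputable_pair.
    by apply: tcomputable_size; apply: tcomputable_coset_reps.
  apply: (tcomputable_map (f := fun=> word_val (@fgen A))).
    by apply: tcomputable_word_val; tc_var.
  exact: tcomputable_coset_reps.
- exact: tcomputable_cst.
Qed.

(** * Correctness *)

Lemma mem_prefixes w p : (p \in prefixes w) = prefix p w.
Proof.
elim: w p => [|l w IHw] [|k p] //=; rewrite inE /=.
apply/mapP/andP => [[u uw [-> ->]]|[/eqP -> pw]]; first by rewrite eqxx -IHw.
by exists p; rewrite ?IHw.
Qed.

Lemma mem_gen_prefixes vs p :
  reflect (p = [::] \/ exists2 v, v \in vs & prefix p v) (p \in gen_prefixes vs).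
Proof.
rewrite inE; apply: (iffP orP) => -[].
- by move=> /eqP; left.
- move=> /flattenP[_ /mapP[v vvs ->]]; rewrite mem_prefixes; right; by exists v.
- by move=> ->; left.
- move=> [v vvs pv]; right; apply/flattenP; exists (prefixes v).
    exact: map_f.
  by rewrite mem_prefixes.
Qed.

Lemma gen_prefixes_prefix vs p q :
  prefix p q -> q \in gen_prefixes vs -> p \in gen_prefixes vs.
Proof.
move=> pq /mem_gen_prefixes[q0|[v vvs qv]]; apply/mem_gen_prefixes.
  by left; move: pq; rewrite q0; case: p.
by right; exists v => //; apply: prefix_trans qv.
Qed.

Lemma mem_neighbours_rcons vs p l :
  p \in gen_prefixes vs -> rcons p l \in neighbours vs.
Proof.
move=> pP; rewrite mem_cat; apply/orP; right; apply/flattenP.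
exists [seq rcons p k | k <- enum {: letter}]; first exact: (map_f _ pP).
by apply: map_f; rewrite mem_enum.
Qed.

Lemma gen_prefixes_neighbours vs p :
  p \in gen_prefixes vs -> p \in neighbours vs.
Proof. by move=> pP; rewrite mem_cat pP. Qed.

Lemma neighbours_rcons vs p l : rcons p l \in neighbours vs -> p \in neighbours vs.
Proof.
rewrite mem_cat => /orP[|/flattenP[_ /mapP[q qP ->] /mapP[k _ /eqP]]].
  by move=> /(gen_prefixes_prefix (prefix_rcons _ _))/gen_prefixes_neighbours.
by rewrite eqseq_rcons => /andP[/eqP -> _]; apply: gen_prefixes_neighbours.
Qed.

Lemma mem_seqs_of (T : eqType) (s : seq T) n t :
  (t \in seqs_of s n) = (size t == n) && all (fun z => z \in s) t.
Proof.
elim: n t => [|n IHn] t; first by rewrite inE; case: t.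
rewrite /= -/(seqs_of s n); apply/flattenP/idP.
  move=> [_ /mapP[z zs ->] /mapP[r]]; rewrite IHn => /andP[/eqP <- rs] ->.
  by rewrite /= eqxx zs.
case: t => //= z t; rewrite eqSS => /andP[tn /andP[zs ts]].
exists [seq z :: r | r <- seqs_of s n]; first exact: (map_f _ zs).
by apply: map_f; rewrite IHn tn.
Qed.

Lemma undup_by_sub (T : eqType) (e : rel T) s : {subset undup_by e s <= s}.
Proof.
elim: s => //= x s IHs y; rewrite inE; case: ifP => _.
  by move/IHs->; rewrite orbT.
by rewrite inE => /orP[->//|/IHs ->]; rewrite orbT.
Qed.

(** An element need not be related to itself under an arbitrary [e], whence the two alternatives. *)
Lemma undup_by_cover (T : eqType) (e : rel T) s x :
  x \in s -> x \in undup_by e s \/ exists2 y, y \in undup_by e s & e x y.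
Proof.
elim: s => //= y s IHs; rewrite inE => /orP[/eqP ->|/IHs[xs|[z zs xz]]].
- by case: ifPn => [/hasP|_]; [right|left; rewrite mem_head].
- by left; case: ifP; rewrite // inE xs orbT.
- by right; exists z => //; case: ifP; rewrite // inE zs orbT.
Qed.

Lemma undup_by_pairwise (T : Type) (e : rel T) s :
  pairwise (fun x y => ~~ e x y) (undup_by e s).
Proof.
elim: s => //= x s IHs; case: ifPn => //= nx; rewrite IHs andbT.
by rewrite all_predC.
Qed.

(** * Right actions of words on an arbitrary set *)

Section Walks.
Variables (T : Type) (st : letter -> T -> T).
Hypothesis stK : forall l, cancel (st l) (st (letter_inv l)).

Local Notation walk := (foldl (fun y l => st l y)).

(** If [l] cancels against the head of [w], that head undoes the step along [l]. *)
Lemma walk_push l w x : walk x (push l w) = walk (st l x) w.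
Proof.
by case: w => //= k w; case: eqP => [->|//] /=; rewrite stK.
Qed.

Lemma walk_foldr_push u w x : walk x (foldr (@push A) w u) = walk (walk x u) w.
Proof. by elim: u x => //= l u IHu x; rewrite walk_push IHu. Qed.

Lemma walk_word_val x w : walk x (word_val (@fgen A) w) = walk x w.
Proof. by rewrite fword_word_val walk_foldr_push. Qed.

Lemma walk_inj w : injective (walk^~ w).
Proof.
by elim: w => //= l w IHw x y /IHw /(congr1 (st (letter_inv l))); rewrite !stK.
Qed.

(** Walking along [g / h] and then [h] is walking along [g]; if [g] and [h] both fix [x], cancelling
    the walk along [h] shows that [g / h] does. *)
Lemma walk_stab_closed x :
  group_closed (mem [set g : freeGroup A | walk x g = x]).
Proof.
split=> [|g h]; rewrite !inE//= => gx hx.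
have := walk_foldr_push (g / h)%g h x.
rewrite -[foldr _ _ _]/(fword (g / h * h)%g) divgK gx => /esym.
by rewrite -[X in _ = X]hx => /walk_inj.
Qed.

End Walks.

(** * Cosets of the subgroup generated by the words *)

Section Subgroup.
Variable vs : seq word.
Let H := generated [set word_val (@fgen A) v | v in [set` vs]].
Local Notation wv := (word_val (@fgen A)).
(** Equality of the right cosets of [p] and [q], see [right_coset_eq]. *)
Local Notation same p q := (H (wv p / wv q)%g).

Lemma generated_closed : group_closed (mem H).
Proof.
split=> [|x y].
  by rewrite inE => K [[+ _] _]; rewrite inE.
rewrite !inE => Hx Hy K [Kcl vK].
have Kx := Hx K (conj Kcl vK); have Ky := Hy K (conj Kcl vK).
by case: Kcl => _ /(_ x y); rewrite !inE; apply.
Qed.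

Lemma gen1 : H 1%g.
Proof. by have [+ _] := generated_closed; rewrite inE. Qed.

Lemma genV x : H x -> H x^-1%g.
Proof. by have := group_closedV generated_closed (x := x); rewrite !inE. Qed.

Lemma genM x y : H x -> H y -> H (x * y)%g.
Proof.
by have := group_closedM generated_closed (x := x) (y := y); rewrite !inE.
Qed.

Lemma gen_word v : v \in vs -> H (wv v).
Proof. by move=> vvs; apply: sub_gen_smallest; exists v. Qed.

Lemma same_refl x : H (x / x)%g.
Proof. by rewrite divgg; apply: gen1. Qed.

Lemma same_sym x y : H (x / y)%g -> H (y / x)%g.
Proof. by move=> /genV; rewrite invgF. Qed.

Lemma same_trans y x z : H (x / y)%g -> H (y / z)%g -> H (x / z)%g.
Proof. by move=> xy /(genM xy); rewrite mulgA divgK. Qed.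

Lemma same_mulr z x y : H (x * z / (y * z))%g <-> H (x / y)%g.
Proof. by rewrite invgM mulgA mulgK. Qed.

(** The stabiliser of [x] is a subgroup containing the generators, hence [H]. The set acted on is
    arbitrary because this serves both the finite tables and the infinite covering. *)
Lemma walk_same (T : Type) (st : letter -> T -> T) x p q :
  (forall l, cancel (st l) (st (letter_inv l))) ->
  (forall v, v \in vs -> foldl (fun y l => st l y) x v = x) -> same p q ->
  foldl (fun y l => st l y) x p = foldl (fun y l => st l y) x q.
Proof.
move=> stK fix_vs Hpq.
have sub : H `<=` [set g | foldl (fun y l => st l y) x (fword g) = x].
  apply: smallest_sub; first exact: (walk_stab_closed stK).
  by move=> _ [v vvs <-] /=; rewrite walk_word_val//; apply: fix_vs.
rewrite -(walk_word_val stK x p) -(divgK (wv q) (wv p)) /=.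
by rewrite walk_foldr_push// (sub _ Hpq) walk_word_val.
Qed.

Let P := neighbours vs.
Let n := size P.

(** Numbers the coset of [g] by the first word of [P] in it; the value [n] means that there is none.
    Words may share a coset, so some numbers below [n] may be skipped. *)
Definition coset_index (g : freeGroup A) : nat :=
  find (fun q => `[< H (g / wv q)%g >]) P.

Lemma coset_index_same x y : H (x / y)%g -> coset_index x = coset_index y.
Proof.
move=> xy; apply: eq_find => q; apply/asboolP/asboolP; apply: same_trans => //.
exact: same_sym.
Qed.

(** The bound excludes the default [n], which unrelated cosets share. *)
Lemma same_coset_index x y :
  coset_index x = coset_index y -> coset_index y < n -> H (x / y)%g.
Proof.
rewrite /n -has_find => exy; have := exy; rewrite {1}/coset_index => ex hy.
have hx : has (fun q => `[< H (x / wv q)%g >]) P by rewrite has_find ex -has_find.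
have /asboolP Hx := nth_find [::] hx; have /asboolP Hy := nth_find [::] hy.
by apply: same_trans Hx _; rewrite ex; apply: same_sym.
Qed.

Lemma coset_index_lt p : p \in P -> coset_index (wv p) < n.
Proof.
move=> pP; rewrite /n -has_find; apply/hasP; exists p => //.
by apply/asboolP; apply: same_refl.
Qed.

Lemma coset_index1 : coset_index (wv [::]) = 0.
Proof.
by rewrite /coset_index /P /=; case: asboolP => // /(_ (same_refl _)).
Qed.

(** * The partial action of the letters on cosets and its completion *)

Lemma wv_rcons p l : wv (rcons p l) = (wv p * letter_val (@fgen A) l)%g.
Proof. by rewrite /word_val big_rcons. Qed.

Lemma same_rcons l p q : same (rcons p l) (rcons q l) <-> same p q.
Proof. by rewrite !wv_rcons; apply: same_mulr. Qed.

Lemma letter_val_inv l :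
  letter_val (@fgen A) (letter_inv l) = (letter_val (@fgen A) l)^-1%g.
Proof. by case: l => a //=; rewrite invgK. Qed.

Lemma wv_rcons_inv p l : wv (rcons (rcons p l) (letter_inv l)) = wv p.
Proof. by rewrite !wv_rcons letter_val_inv mulgK. Qed.

(** The complements of [D] and of its image have the same size, so matching their enumerations
    completes [f]. *)
Lemma extend_to_perm (T : finType) (D : {set T}) (f : T -> T) :
  {in D &, injective f} -> exists s : {perm T}, {in D, s =1 f}.
Proof.
move=> f_inj; pose E := (f @: D)%SET.
have cardDE : #|(~: D)%SET| = #|(~: E)%SET|.
  by rewrite cardsCs [RHS]cardsCs !finset.setCK card_in_imset.
pose g x := if x \in D then f x
  else nth x (enum (~: E)%SET) (index x (enum (~: D)%SET)).
have gN x : x \notin D -> g x \notin E.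
  move=> xD; rewrite /g (negPf xD) -finset.in_setC -mem_enum mem_nth//.
  by rewrite -cardE -cardDE cardE index_mem mem_enum finset.in_setC.
have gD x : x \in D -> g x = f x by rewrite /g => ->.
have gE x : x \in D -> g x \in E by move=> xD; rewrite gD//; apply: imset_f.
have g_inj : injective g.
  move=> x y gxy.
  have [xD|xD] := boolP (x \in D); have [yD|yD] := boolP (y \in D).
  - by apply: f_inj => //; rewrite -!gD.
  - by have := gN _ yD; rewrite -gxy gE.
  - by have := gN _ xD; rewrite gxy gE.
  have ix z : z \notin D -> index z (enum (~: D)%SET) < size (enum (~: E)%SET).
    by move=> zD; rewrite -cardE -cardDE cardE index_mem mem_enum finset.in_setC.
  move: gxy; rewrite /g (negPf xD) (negPf yD) (set_nth_default y) ?ix//.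
  move=> /eqP; rewrite nth_uniq ?ix ?enum_uniq// => /eqP exy.
  rewrite -[x](nth_index x (s := enum (~: D)%SET)) ?mem_enum ?finset.in_setC//.
  by rewrite exy nth_index ?mem_enum ?finset.in_setC.
by exists (perm g_inj) => x xD; rewrite permE gD.
Qed.

Lemma letter_perm a : exists s : {perm 'I_n}, forall p (i : 'I_n),
  coset_index (wv (rcons p (inl a))) < n -> coset_index (wv p) = i ->
  s i = coset_index (wv (rcons p (inl a))) :> nat.
Proof.
pose nextw (i : 'I_n) := rcons (nth [::] P i) (inl a).
(* The first condition keeps the numbers that are in use, the second those whose translate by [a]
   has a number too; there right multiplication by [a] is injective. *)
pose D := [set i : 'I_n | (coset_index (wv (nth [::] P i)) == i) &&
                (coset_index (wv (nextw i)) < n)]%SET.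
pose f (i : 'I_n) := insubd i (coset_index (wv (nextw i))).
have fE i : i \in D -> f i = coset_index (wv (nextw i)) :> nat.
  by rewrite inE => /andP[_ lt]; rewrite val_insubd lt.
have [|s sf] := @extend_to_perm _ D f.
  move=> i j iD jD /(congr1 val) /=; rewrite !fE// => eij.
  move: iD jD; rewrite !inE => /andP[/eqP ei _] /andP[/eqP ej ltj].
  apply: val_inj; rewrite -[val i]ei -[val j]ej; apply: coset_index_same.
  by apply/same_rcons; apply: same_coset_index eij ltj.
exists s => p i lt_pa ip.
have Hi : H (wv p / wv (nth [::] P i))%g.
  have hp : has (fun q => `[< H (wv p / wv q)%g >]) P.
    by rewrite has_find; move: (ltn_ord i); rewrite -ip.
  by have /asboolP := nth_find [::] hp; rewrite -/(coset_index _) ip.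
have Hn : H (wv (rcons p (inl a)) / wv (nextw i))%g by apply/same_rcons.
have iD : i \in D.
  by rewrite inE -(coset_index_same Hi) ip eqxx /= -(coset_index_same Hn).
by rewrite sf// fE//; apply/esym/coset_index_same.
Qed.

(* M. Hall: the partial action on the cosets of the words in [neighbours vs]
   extends to an action on a set of [n] points. *)
Lemma coset_table : exists tb, [/\ tb \in tables n, is_action n tb &
  forall p, p \in P -> run tb p 0 = coset_index (wv p)].
Proof.
have [s sP] := choice letter_perm.
(* Only the basis letters are chosen; the inverse letters act by the inverse permutations. *)
pose st l (i : 'I_n) := match l with inl a => s a i | inr a => (s a)^-1%g i end.
pose tb := [seq [seq val (st l i) | i <- enum 'I_n] | l <- enum {: letter}].
have stepE l (i : 'I_n) : step tb l i = st l i.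
  rewrite /step /tb (nth_map l) ?index_mem ?mem_enum// nth_index ?mem_enum//.
  by rewrite (nth_map i) ?size_enum_ord// nth_ord_enum.
have stK l : cancel (st l) (st (letter_inv l)).
  by case: l => a i /=; rewrite ?permK ?permKV.
exists tb; split.
- rewrite /tables mem_seqs_of size_map -cardE eqxx andTb.
  apply/allP => _ /mapP[l _ ->].
  rewrite mem_seqs_of size_map size_enum_ord eqxx andTb.
  by apply/allP => _ /mapP[i _ ->]; rewrite mem_iota add0n andTb ltn_ord.
- apply/allP => l _; apply/allP => x; rewrite mem_iota add0n andTb => ltx.
  by rewrite -[x]/(val (Ordinal ltx)) !stepE stK.
have st_next p l : p \in P -> rcons p l \in P ->
    step tb l (coset_index (wv p)) = coset_index (wv (rcons p l)).
  move=> pP plP.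
  rewrite -[coset_index _]/(val (Ordinal (coset_index_lt pP))) stepE.
  case: l plP => a plP; first by apply: sP => //; apply: coset_index_lt.
  rewrite -[RHS]/(val (Ordinal (coset_index_lt plP))); congr val.
  (* For an inverse letter apply [s a] to both sides: a step along [a] from the coset of
     [rcons p (inr a)] returns to that of [p]. *)
  apply: (@perm_inj _ (s a)); rewrite /st permKV; apply: val_inj => /=.
  by rewrite (sP a (rcons p (inr a))) ?(wv_rcons_inv p (inr a))// coset_index_lt.
elim/last_ind => [_|p l IHp plP]; first by rewrite coset_index1.
have pP := neighbours_rcons plP.
by rewrite /run foldl_rcons -/(run tb p 0) IHp// st_next.
Qed.

(** [is_action] inspects the points below [n]; beyond them every row, having length [n], leaves the
    point fixed. *)
Lemma stepK tb : tb \in tables n -> is_action n tb ->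
  forall l, cancel (step tb l) (step tb (letter_inv l)).
Proof.
rewrite /tables mem_seqs_of => /andP[/eqP stb /allP tbP] /allP act l x.
have [ltx|lenx] := ltnP x n.
  have /allP/(_ x) := act l (mem_enum _ _).
  by rewrite mem_iota add0n andTb => /(_ ltx)/eqP.
have fixx k : step tb k x = x.
  rewrite /step nth_default//.
  have /tbP : nth [::] tb (index k (enum {: letter})) \in tb.
    by rewrite mem_nth// stb cardE index_mem mem_enum.
  by rewrite mem_seqs_of => /andP[/eqP ->].
by rewrite !fixx.
Qed.

(** If the cosets differ, the table of [coset_table] separates the words, since it sends 0 to the
    numbers of their cosets. If they agree, [walk_same] shows that no action separates them. *)
Lemma same_cosetP p q : p \in P -> q \in P ->
  reflect (same p q) (same_coset vs p q).
Proof.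
move=> pP qP; apply: (iffP allP) => [|Hpq tb tbt].
  have [tb [tbt act run_tb]] := coset_table.
  move=> /(_ tb tbt); rewrite act /= /separates !run_tb// negb_and negbK.
  case/orP => [|/eqP epq]; last first.
    by apply: same_coset_index => //; apply: coset_index_lt.
  (* No generator moves 0 in this table, since its coset is [H], of number 0. *)
  case/allPn => v vvs.
  rewrite run_tb ?(coset_index_same (y := wv [::])) ?coset_index1//.
    by rewrite /word_val big_nil invg1 mulg1; apply: gen_word.
  apply: gen_prefixes_neighbours; apply/mem_gen_prefixes; right.
  by exists v => //; apply: prefix_refl.
apply/implyP => act; rewrite /separates negb_and negbK -implybE.
apply/implyP => /allP fix_vs; apply/eqP; apply: walk_same Hpq.
  exact: stepK.
by move=> v vvs; apply/eqP; apply: fix_vs.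
Qed.

(** * Index and transversal when the prefix cosets are closed *)

Lemma right_cosetE g : right_coset H g = [set x | H (x / g)%g].
Proof.
apply/seteqP; split => [_ [h Hh <-]|x Hx] /=; first by rewrite mulgK.
by exists (x / g)%g => //; rewrite divgK.
Qed.

Lemma right_coset_eq g h : right_coset H g = right_coset H h <-> H (g / h)%g.
Proof.
rewrite !right_cosetE; split=> [/seteqP[+ _]|gh].
  by move=> /(_ g); apply; apply: same_refl.
apply/seteqP; split=> x /= xg; first exact: same_trans gh.
exact: same_trans xg (same_sym gh).
Qed.

Lemma wv_cat u w : wv (u ++ w) = (wv u * wv w)%g.
Proof. by rewrite /word_val big_cat. Qed.

(** Induction on the word: if [w] lies in the coset of a prefix [q], then [rcons w l] lies in that
    of [rcons q l], again the coset of a prefix. *)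
Lemma closed_cover : closed_prefixes vs ->
  forall g, exists2 q, q \in gen_prefixes vs & H (g / wv q)%g.
Proof.
move=> /allP clos g; rewrite -(word_val_fgen g).
elim/last_ind: (fword g) => [|w l [q qP wq]].
  by exists [::] => //; apply: same_refl.
have /allP/(_ l (mem_enum _ _))/hasP[r rP] := clos q qP.
move=> /(same_cosetP (mem_neighbours_rcons l qP) (gen_prefixes_neighbours rP)).
by move=> qr; exists r => //; apply: same_trans qr; apply/same_rcons.
Qed.

Lemma same_in_prefixesP p q : p \in gen_prefixes vs -> q \in gen_prefixes vs ->
  reflect (same p q) (same_coset vs p q).
Proof. by move=> pP qP; apply: same_cosetP; apply: gen_prefixes_neighbours. Qed.

Lemma coset_reps_sub : {subset coset_reps vs <= gen_prefixes vs}.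
Proof. exact: undup_by_sub. Qed.

Lemma coset_reps_cover p : p \in gen_prefixes vs ->
  exists2 q, q \in coset_reps vs & same p q.
Proof.
move=> pP; have [pR|[q qR pq]] := undup_by_cover (same_coset vs) pP.
  by exists p => //; apply: same_refl.
by exists q => //; apply/(same_in_prefixesP pP (coset_reps_sub qR)).
Qed.

Lemma coset_reps_inj i j : i < size (coset_reps vs) -> j < size (coset_reps vs) ->
  same (nth [::] (coset_reps vs) i) (nth [::] (coset_reps vs) j) -> i = j.
Proof.
(* [undup_by_pairwise] compares an element with later ones only. *)
wlog ltij : i j / i < j => [hw|_ ltj Hij].
  case: (ltngtP i j) => // ij lti ltj Hij; first exact: hw.
  by apply/esym/hw => //; apply: same_sym.
have lti := ltn_trans ltij ltj.
have := undup_by_pairwise (same_coset vs) (gen_prefixes vs).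
move=> /(pairwiseP [::])/(_ i j lti ltj ltij)/negP[].
by apply/same_in_prefixesP => //; apply/coset_reps_sub/mem_nth.
Qed.

Lemma closed_prefixes_index : closed_prefixes vs ->
  let gs := map wv (coset_reps vs) in
  [/\ finite_index H, has_index H (size (coset_reps vs)) &
      coset_transversal H (tnth (in_tuple gs))].
Proof.
move=> clos gs; pose c i := right_coset H (tnth (in_tuple gs) i).
have sgs : size gs = size (coset_reps vs) by rewrite size_map.
have gE i : tnth (in_tuple gs) i = wv (nth [::] (coset_reps vs) i).
  by rewrite (tnth_nth 1%g) /= (nth_map [::])// -sgs.
have c_inj i j : H (tnth (in_tuple gs) i / tnth (in_tuple gs) j)%g -> i = j.
  rewrite !gE => /coset_reps_inj eij; apply/val_inj/eij; by rewrite -sgs.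
have c_surj g : exists i, H (g / tnth (in_tuple gs) i)%g.
  have [q qP gq] := closed_cover clos g.
  have [r rR qr] := coset_reps_cover qP.
  have lt : index r (coset_reps vs) < size gs by rewrite sgs index_mem.
  by exists (Ordinal lt); rewrite gE /= nth_index//; apply: same_trans qr.
have idx : has_index H (size (coset_reps vs)).
  rewrite /has_index -sgs; have -> : right_cosets H = range c.
    apply/seteqP; split=> [_ [g _ <-]|_ [i _ <-]]; last first.
      by exists (tnth (in_tuple gs) i).
    have [i gi] := c_surj g; exists i => //; apply/right_coset_eq.
    exact: same_sym gi.
  rewrite (card_eqr card_II); apply: inj_card_eq => i j _ _.
  by move=> /right_coset_eq; apply: c_inj.
split=> //; first by exists (size (coset_reps vs)).
split=> [i j _ _ [x]|].
  rewrite !right_cosetE => -[xi xj]; apply: c_inj.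
  exact: same_trans (same_sym xi) xj.
apply/seteqP; split=> // g _; have [i gi] := c_surj g.
by exists i => //; rewrite right_cosetE.
Qed.

Lemma letter_inv_neq l : letter_inv l != l.
Proof. by case: l. Qed.

(** * The covering that counts the crossings of one edge *)

Section Winding.
Variables (p : word) (l : letter).

Let marked (C : set (freeGroup A)) : int := `[< C = right_coset H (wv p) >] : nat.

Let translate (C : set (freeGroup A)) m : set (freeGroup A) :=
  [set x | C (x / letter_val (@fgen A) m)%g].

(** Signed crossings of the edge labelled [l] that leaves the coset of [p]: +1 along [l] from that
    coset, -1 when [letter_inv l] leads back to it. *)
Let winding C m : int :=
  if m == l then marked C
  else if m == letter_inv l then (- marked (translate C m))%R else 0%R.

Let wind m (Ci : set (freeGroup A) * int) : set (freeGroup A) * int :=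
  (translate Ci.1 m, (Ci.2 + winding Ci.1 m)%R).

Lemma translateK C m : translate (translate C m) (letter_inv m) = C.
Proof.
by apply/seteqP; split=> x; rewrite /translate /= letter_val_inv invgK mulgK.
Qed.

Lemma translate_coset w m :
  translate (right_coset H (wv w)) m = right_coset H (wv (rcons w m)).
Proof.
rewrite !right_cosetE; apply/seteqP; split=> x;
  by rewrite /translate /= wv_rcons invgM mulgA.
Qed.

(** A letter and its inverse run along the same edge in opposite directions, so their contributions
    cancel; no letter is its own inverse, so the branches of [winding] do not overlap. *)
Lemma windK m : cancel (wind m) (wind (letter_inv m)).
Proof.
move=> [C i]; rewrite /wind /= translateK; congr pair.
rewrite -GRing.addrA /winding translateK (inj_eq (inv_inj (@letter_invK A))).
rewrite (inv_eq (@letter_invK A)); case: (eqVneq m l) => [->|ml].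
  by rewrite eq_sym (negPf (letter_inv_neq l)) GRing.subrr GRing.addr0.
by case: ifP => _; rewrite ?GRing.addNr GRing.addr0.
Qed.

(** Each step along [l] adds a value of [marked], which is 0 or 1. *)
Lemma wind_nseq k C i :
  (i <= (foldl (fun y m => wind m y) (C, i) (nseq k l)).2)%R.
Proof.
elim: k C i => //= k IHk C i; apply: Order.PreorderTheory.le_trans (IHk _ _).
by rewrite /= /winding eqxx Num.Theory.lerDl.
Qed.

(** Crossing the edge forwards would end at a prefix in the coset of [rcons p l], and crossing it
    backwards would start from one; [out] forbids both. *)
Lemma wind_gen_prefixes w :
  (forall q, q \in gen_prefixes vs -> ~ same (rcons p l) q) ->
  w \in gen_prefixes vs ->
  foldl (fun y m => wind m y) (right_coset H (wv [::]), 0%R) w =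
    (right_coset H (wv w), 0%R).
Proof.
move=> out; elim/last_ind: w => // w m IHw wmP.
have wP := gen_prefixes_prefix (prefix_rcons w m) wmP.
rewrite foldl_rcons IHw// /wind /= translate_coset GRing.add0r; congr pair.
rewrite /winding translate_coset /marked; case: eqP => [ml|_].
  case: asboolP => // /right_coset_eq Hwp; case: (out _ wmP); apply: same_sym.
  by rewrite ml; apply/same_rcons.
case: eqP => // ml; case: asboolP => // /right_coset_eq Hwp; case: (out _ wP).
apply: same_sym; rewrite -(wv_rcons_inv w m) ml letter_invK.
by apply/same_rcons; rewrite -ml.
Qed.

Lemma no_return k :
  (forall q, q \in gen_prefixes vs -> ~ same (rcons p l) q) ->
  p \in gen_prefixes vs -> ~ same (p ++ nseq k.+1 l) p.
Proof.
move=> out pP Hp.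
pose base := (right_coset H (wv [::]), 0%R : int).
have fix_vs v : v \in vs -> foldl (fun y m => wind m y) base v = base.
  move=> vvs; rewrite wind_gen_prefixes//; last first.
    by apply/mem_gen_prefixes; right; exists v; rewrite ?prefix_refl.
  congr pair; apply/right_coset_eq.
  by rewrite /word_val big_nil invg1 mulg1; apply: gen_word.
have := walk_same windK fix_vs Hp.
rewrite foldl_cat !wind_gen_prefixes//= => /(congr1 snd) /= e.
(* The first of the [k.+1] letters leaves the coset of [p] and raises the count to 1; the other [k]
   cannot lower it, yet by [walk_same] it ends at 0. *)
have := wind_nseq k (translate (right_coset H (wv p)) l)
  (0 + winding (right_coset H (wv p)) l)%R.
by rewrite e /winding eqxx /marked asboolT.
Qed.

End Winding.

(** Pigeonhole on the cosets of the words [p ++ nseq k l]: if the exponents [i < j] give the same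
    coset, cancelling [nseq i l] on the right leaves the positive exponent [j - i]. *)
Lemma finite_index_return p l : finite_index H ->
  exists k, same (p ++ nseq k.+1 l) p.
Proof.
move=> fin; pose c k := right_coset H (wv (p ++ nseq k l)).
have [i [j [ltij /right_coset_eq Hij]]] : exists i j, i < j /\ c j = c i.
  apply: contrapT => nex; apply: infinite_nat.
  have c_inj : injective c.
    move=> i j cij; case: (ltngtP i j) => // lt; case: nex.
      by exists i, j.
    by exists j, i.
  have cfin : finite_set (range c).
    by apply: sub_finite_set fin => _ [k _ <-]; exists (wv (p ++ nseq k l)).
  by have /eq_finite_set <- := @inj_card_eq _ _ [set: nat] c (in2W c_inj).
exists (j - i).-1; rewrite prednK ?subn_gt0//.
move: Hij; rewrite -{1}(subnK (ltnW ltij)) nseqD catA !(wv_cat _ (nseq i l)).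
by move/same_mulr.
Qed.

(** If [rcons p l] lay in no prefix coset, [finite_index_return] would contradict [no_return]. *)
Lemma finite_index_closed : finite_index H -> closed_prefixes vs.
Proof.
move=> fin; apply/allP => p pP; apply/allP => l _; apply: contraT => /hasPn nhas.
have [k] := finite_index_return p l fin.
case/no_return => // q qP Hq; have /negP[] := nhas q qP.
apply/same_cosetP => //; first exact: mem_neighbours_rcons.
exact: gen_prefixes_neighbours.
Qed.

End Subgroup.
End Algorithm.

Theorem mainTheorem3 (A : finType) :
  exists2 f : seq (seq (A + A)) -> option (nat * seq (freeGroup A)),
    computable f &
    forall vs : seq (seq (A + A)),
      let H := generated [set word_val (@fgen A) v | v in [set` vs]] in
      match f vs with
      | Some (n, gs) =>
          [/\ finite_index H,
              has_index H n &
              coset_transversal H (tnth (in_tuple gs))]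
      | None => ~ finite_index H
      end.
Proof.
exists (@index_algorithm A); first exact: computable_index_algorithm.
move=> vs; rewrite /index_algorithm; case: ifPn => [|/negP nclos].
  exact: closed_prefixes_index.
by move=> /finite_index_closed.
Qed.
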